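(* For every binary stiffened-gas mixture state (with all quantities as defined in the context), the squared speed of sound $c_s^2$ satisfies $$c_s^2\leq\gamma(\gamma-1)c_V\theta\leq\Big\langle\frac{\rho_k}{\rho}c_{sk}^2\Big\rangle=\frac{1}{\rho}\langle\alpha_k\gamma_k(p_k+p_{*k})\rangle,$$ where $c_{sk}^2:=\gamma_k(\gamma_k-1)c_{Vk}\theta$, $k=1,2$.
   Context: $\langle\cdot\rangle$ denotes summation over $k=1,2$. Physical constants for $k=1,2$: $c_{Vk}>0$, $\gamma_k>1$, $R_k=(\gamma_k-1)c_{Vk}>0$, $p_{*k}\geq 0$, $\varepsilon_{0k}\in\mathbb{R}$. A binary stiffened-gas mixture state consists of component densities $r_k>0$, volume fractions $0<\alpha_k<1$ ($k=1,2$) and a temperature $\theta>0$ such that $\alpha_1+\alpha_2=1$ and the component pressures $p_k=R_kr_k\theta-p_{*k}$ are equal to a common pressure: $p=p_1=p_2>0$. The component specific internal energies are $\varepsilon_k=c_{Vk}\theta+p_{*k}/r_k+\varepsilon_{0k}$. Put $\rho_k=\alpha_kr_k$, $\rho=\langle\rho_k\rangle$, and define $\varepsilon,\varepsilon_0,R,c_V,\gamma$ by $\rho\varepsilon=\langle\rho_k\varepsilon_k\rangle$, $\rho\varepsilon_0=\langle\rho_k\varepsilon_{0k}\rangle$, $\rho R=\langle R_k\rho_k\rangle$, $\rho c_V=\langle c_{Vk}\rho_k\rangle$, $\gamma=R/c_V+1$. Put $\sigma^{(k)}=\dfrac{R_k\rho_k}{c_V\rho}$ and $$b=\langle\sigma^{(k)}(\rho(\varepsilon-\varepsilon_0)-p_{*k})-p_{*k}\rangle,\qquad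 c=(\sigma^{(1)}p_{*2}+\sigma^{(2)}p_{*1})\rho(\varepsilon-\varepsilon_0)-\gamma p_{*1}p_{*2},\qquad d=b^2+4c.$$ It is known that $d>0$ and that the common pressure is $p=p_+:=\tfrac12(b+\sqrt d)$. The squared speed of sound of the mixture is $c_s^2:=\partial_\rho p_++\frac{p_+}{\rho^2}\partial_\varepsilon p_+$, where $b$ and $c$ (hence $p_+$) are regarded as functions of $(\rho,\varepsilon)$ with $\varepsilon_0,\sigma^{(1)},\sigma^{(2)}$ (hence also $\gamma=1+\langle\sigma^{(k)}\rangle$) held constant; equivalently $c_s^2=\dfrac{\gamma(p_++p_{*1})(p_++p_{*2})}{\rho\sqrt d}$. *)

(* Defs.v *)
(* Standard-library reals, with Coquelicot for derivatives. *)
From Stdlib Require Import Reals.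
From Coquelicot Require Import Coquelicot.
Open Scope R_scope.

Inductive component : Set := K1 | K2.

Definition sum12 (f : component -> R) : R := f K1 + f K2.

Record constants := Constants {
  cVk : component -> R;
  gammak : component -> R;
  pstar : component -> R;
  eps0k : component -> R
}.

Definition admissible_constants (g : constants) : Prop :=
  forall k, 0 < cVk g k /\ 1 < gammak g k /\ 0 <= pstar g k.

Definition Rk (g : constants) (k : component) : R := (gammak g k - 1) * cVk g k.

Record state := State {
  dens : component -> R;      (* the component densities r_k *)
  alpha : component -> R;     (* the volume fractions *)
  theta : R;                  (* the common temperature *)
  press : R                   (* the common pressure p *)
}.

Definition pk (g : constants) (s : state) (k : component) : R :=
  Rk g k * dens s k * theta s - pstar g k.

Definition mixture_state (g : constants) (s : state) : Prop :=
  (forall k, 0 < dens s k) /\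
  (forall k, 0 < alpha s k < 1) /\
  0 < theta s /\
  alpha s K1 + alpha s K2 = 1 /\
  (forall k, pk g s k = press s) /\
  0 < press s.

Definition epsk (g : constants) (s : state) (k : component) : R :=
  cVk g k * theta s + pstar g k / dens s k + eps0k g k.

Definition rhok (s : state) (k : component) : R := alpha s k * dens s k.

Definition rho (s : state) : R := sum12 (rhok s).

Definition mass_mean (s : state) (f : component -> R) : R :=
  sum12 (fun k => rhok s k * f k) / rho s.

Definition eps (g : constants) (s : state) : R := mass_mean s (epsk g s).
Definition eps0 (g : constants) (s : state) : R := mass_mean s (eps0k g).
Definition Rmix (g : constants) (s : state) : R := mass_mean s (Rk g).
Definition cV (g : constants) (s : state) : R := mass_mean s (cVk g).
Definition gamma (g : constants) (s : state) : R := Rmix g s / cV g s + 1.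

Definition sigma (g : constants) (s : state) (k : component) : R :=
  Rk g k * rhok s k / (cV g s * rho s).

(* In the next four functions [x] and [y] are the variables rho and eps;
   everything taken from the state [s], namely eps0, sigma and gamma, is
   frozen at its value in [s]. *)
Definition b_at (g : constants) (s : state) (x y : R) : R :=
  sum12 (fun k => sigma g s k * (x * (y - eps0 g s) - pstar g k) - pstar g k).

Definition c_at (g : constants) (s : state) (x y : R) : R :=
  (sigma g s K1 * pstar g K2 + sigma g s K2 * pstar g K1) * (x * (y - eps0 g s))
  - gamma g s * pstar g K1 * pstar g K2.

Definition d_at (g : constants) (s : state) (x y : R) : R :=
  (b_at g s x y) ^ 2 + 4 * c_at g s x y.

Definition pplus_at (g : constants) (s : state) (x y : R) : R :=
  (b_at g s x y + sqrt (d_at g s x y)) / 2.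

(* [Derive] returns the actual partial derivatives here: [d_at] is positive at
   (rho, eps) of every mixture state, so [pplus_at] is smooth there. *)
Definition cs2 (g : constants) (s : state) : R :=
  Derive (fun x => pplus_at g s x (eps g s)) (rho s)
  + pplus_at g s (rho s) (eps g s) / (rho s) ^ 2
    * Derive (fun y => pplus_at g s (rho s) y) (eps g s).

Definition cs2k (g : constants) (s : state) (k : component) : R :=
  gammak g k * (gammak g k - 1) * cVk g k * theta s.

(* Main.v *)
Require Import Defs.
From Stdlib Require Import Reals Lra.
From Coquelicot Require Import Coquelicot.
(* Gives [sigma] back its meaning for mixtures, hidden by the partial sums of
   the same name. *)
Import Defs.
Open Scope R_scope.

(** Write [P_k = p + p_{*k} = R_k r_k theta], [m = rho c_V theta] for the
    thermal energy density and [e = rho (eps - eps_0)].  The equations of state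
    become [sigma_k m = alpha_k P_k] and [e + p = gamma m], and, as the volume
    fractions add up to 1, [m S = P_1 P_2] with [S = sigma_1 P_2 + sigma_2 P_1].
    Eliminating [m] gives [(e + p) S = gamma P_1 P_2], which is the quadratic
    equation [p^2 = b p + c].  Here [2 p - b = gamma A - S] with
    [A = alpha_2 P_1 + alpha_1 P_2].

    Both inequalities of the theorem are Cauchy-Schwarz for two weights.
    - With weights [sigma_k] it gives [S <= (gamma - 1) A], so that
      [2 p - b >= A > 0]: the pressure is the larger root and
      [sqrt d = 2 p - b].  The coefficients [b] and [c] depend on [(rho, eps)]
      only through [e]; differentiating the quadratic equation gives
      [dp/de = S / sqrt d], hence
      [c_s^2 = (dp/de) (e + p) / rho = gamma c_V theta S / sqrt d].  The first
      inequality is then [S <= (gamma - 1) (gamma A - S)], that is,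
      [S <= (gamma - 1) A] once more.
    - With weights [rho_k c_{Vk}] and values [gamma_k - 1], whose weighted mean
      is [gamma - 1], it says that the mean of the convex function
      [x (x + 1)] dominates its value at the mean: the second inequality.

    The final equality is [rho_k R_k theta = alpha_k P_k] term by term. *)

(** * Facts on real numbers *)

Lemma weighted_cauchy_schwarz (w1 w2 x1 x2 : R) :
  0 <= w1 -> 0 <= w2 ->
  (w1 * x1 + w2 * x2) ^ 2 <= (w1 + w2) * (w1 * x1 ^ 2 + w2 * x2 ^ 2).
Proof.
  intros h1 h2.
  assert (h : 0 <= w1 * w2 * (x1 - x2) ^ 2)
    by (apply Rmult_le_pos; [now apply Rmult_le_pos | apply pow2_ge_0]).
  lra.
Qed.

Lemma is_derive_affine_comp (f z : R -> R) (k l u z' : R) :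
  is_derive z u z' -> (forall v, f v = k * z v - l) -> is_derive f u (k * z').
Proof.
  intros hz hf.
  apply (is_derive_ext (fun v => k * z v - l)); [intros v; symmetry; apply hf |].
  auto_derive; [now exists z' |].
  change (Derive (fun v => z v) u) with (Derive z u).
  rewrite (is_derive_unique _ _ _ hz). ring.
Qed.

(** Differentiating [p^2 = b p + c] gives [(2 p - b) p' = b' p + c'], and
    [2 p - b] is the square root of the discriminant at the larger root. *)
Lemma is_derive_larger_root (b c : R -> R) (b' c' u p : R) :
  is_derive b u b' -> is_derive c u c' ->
  0 < b u ^ 2 + 4 * c u ->
  p = (b u + sqrt (b u ^ 2 + 4 * c u)) / 2 ->
  is_derive (fun v => (b v + sqrt (b v ^ 2 + 4 * c v)) / 2) u
    ((b' * p + c') / sqrt (b u ^ 2 + 4 * c u)).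
Proof.
  intros hb hc hd ->.
  assert (hq := sqrt_lt_R0 _ hd).
  auto_derive.
  - repeat split; try (eexists; eassumption); exact hd.
  - apply is_derive_unique in hb, hc.
    change (Derive (fun x => b x) u) with (Derive b u).
    change (Derive (fun x => c x) u) with (Derive c u).
    rewrite hb, hc.
    change (b u * (b u * 1)) with (b u ^ 2).
    field. lra.
Qed.

(** * The equations of state *)

Definition shifted_press (g : constants) (s : state) (k : component) : R :=
  press s + pstar g k.

Definition thermal_energy (g : constants) (s : state) : R :=
  rho s * cV g s * theta s.

Definition crossed_sigma (g : constants) (s : state) : R :=
  sigma g s K1 * shifted_press g s K2 + sigma g s K2 * shifted_press g s K1.

Definition crossed_alpha (g : constants) (s : state) : R :=
  alpha s K2 * shifted_press g s K1 + alpha s K1 * shifted_press g s K2.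

Section MixtureState.

Variables (g : constants) (s : state).
Hypotheses (hg : admissible_constants g) (hs : mixture_state g s).

Let P := shifted_press g s.
Let m := thermal_energy g s.
Let S := crossed_sigma g s.
Let A := crossed_alpha g s.
Let e := rho s * (eps g s - eps0 g s).

Lemma theta_pos : 0 < theta s.
Proof. apply hs. Qed.

Lemma alpha_pos k : 0 < alpha s k.
Proof. destruct hs as (_ & h & _). apply (h k). Qed.

Lemma rhok_pos k : 0 < rhok s k.
Proof. apply Rmult_lt_0_compat; [apply alpha_pos | apply hs]. Qed.

Lemma rho_pos : 0 < rho s.
Proof.
  unfold rho, sum12. assert (h1 := rhok_pos K1). assert (h2 := rhok_pos K2). lra.
Qed.

Lemma rho_mass_mean (f : component -> R) :
  rho s * mass_mean s f = sum12 (fun k => rhok s k * f k).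
Proof. unfold mass_mean. field. apply Rgt_not_eq, rho_pos. Qed.

Lemma heat_capacity_pos k : 0 < rhok s k * cVk g k.
Proof. apply Rmult_lt_0_compat; [apply rhok_pos | apply hg]. Qed.

Lemma rho_cV_pos : 0 < rho s * cV g s.
Proof.
  unfold cV. rewrite rho_mass_mean. unfold sum12.
  assert (h1 := heat_capacity_pos K1). assert (h2 := heat_capacity_pos K2). lra.
Qed.

Lemma thermal_energy_pos : 0 < m.
Proof. apply Rmult_lt_0_compat; [apply rho_cV_pos | apply theta_pos]. Qed.

Lemma cV_neq_0 : cV g s <> 0.
Proof. intros h. assert (h' := rho_cV_pos). rewrite h in h'. lra. Qed.

Lemma shifted_press_pos k : 0 < P k.
Proof.
  destruct hs as (_ & _ & _ & _ & _ & hp). destruct (hg k) as (_ & _ & hk).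
  unfold P, shifted_press. lra.
Qed.

Lemma rhok_Rk_theta k : rhok s k * Rk g k * theta s = alpha s k * P k.
Proof.
  destruct hs as (_ & _ & _ & _ & hp & _). specialize (hp k).
  unfold P, shifted_press. rewrite <- hp. unfold pk, rhok. ring.
Qed.

Lemma sigma_thermal_energy k : sigma g s k * m = alpha s k * P k.
Proof.
  rewrite <- rhok_Rk_theta. unfold sigma, m, thermal_energy. field.
  split; [apply Rgt_not_eq, rho_pos | apply cV_neq_0].
Qed.

Lemma sigma_pos k : 0 < sigma g s k.
Proof.
  apply (Rmult_lt_reg_r m); [apply thermal_energy_pos |].
  rewrite Rmult_0_l, sigma_thermal_energy.
  apply Rmult_lt_0_compat; [apply alpha_pos | apply shifted_press_pos].
Qed.

Lemma gamma_sigma : gamma g s = 1 + sigma g s K1 + sigma g s K2.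
Proof.
  assert (hr := rho_pos). assert (hc := cV_neq_0).
  unfold gamma, sigma. unfold Rmix, mass_mean at 1. unfold sum12.
  field. split; lra.
Qed.

Lemma sum_alpha : alpha s K2 = 1 - alpha s K1.
Proof. destruct hs as (_ & _ & _ & h & _). lra. Qed.

Lemma energy_plus_press : e + press s = gamma g s * m.
Proof.
  assert (he : e = m + alpha s K1 * pstar g K1 + alpha s K2 * pstar g K2).
  { unfold e, m, thermal_energy, eps, eps0, cV.
    rewrite Rmult_minus_distr_l, !rho_mass_mean.
    destruct hs as (hr & _).
    assert (h1 := hr K1). assert (h2 := hr K2).
    unfold sum12, epsk, rhok. field. split; lra. }
  rewrite he, gamma_sigma, !Rmult_plus_distr_r, !sigma_thermal_energy, sum_alpha.
  unfold P, shifted_press. ring.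
Qed.

(** This is [alpha_1 + alpha_2 = 1] with [alpha_k = sigma_k m / P_k]. *)
Lemma volume_constraint : m * S = P K1 * P K2.
Proof.
  transitivity (sigma g s K1 * m * P K2 + sigma g s K2 * m * P K1).
  - unfold S, crossed_sigma. fold P. ring.
  - rewrite !sigma_thermal_energy, sum_alpha. ring.
Qed.

(** * The pressure as the larger root *)

(** Multiplied by [P_1 P_2 = m S], this is Cauchy-Schwarz with weights
    [sigma_k], because [P_1 P_2 A = m (sigma_2 P_1^2 + sigma_1 P_2^2)]. *)
Lemma crossed_sigma_le : S <= (gamma g s - 1) * A.
Proof.
  assert (hP : 0 < P K1 * P K2)
    by (apply Rmult_lt_0_compat; apply shifted_press_pos).
  apply (Rmult_le_reg_l (P K1 * P K2)); [exact hP |].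
  assert (hA : P K1 * P K2 * A
               = m * (sigma g s K1 * P K2 ^ 2 + sigma g s K2 * P K1 ^ 2)).
  { transitivity (sigma g s K1 * m * P K2 ^ 2 + sigma g s K2 * m * P K1 ^ 2);
      [rewrite !sigma_thermal_energy; unfold A, crossed_alpha; fold P |]; ring. }
  replace (P K1 * P K2 * ((gamma g s - 1) * A))
    with ((gamma g s - 1) * (P K1 * P K2 * A)) by ring.
  rewrite hA, <- volume_constraint, gamma_sigma.
  replace (m * S * S) with (m * S ^ 2) by ring.
  replace ((1 + sigma g s K1 + sigma g s K2 - 1) *
           (m * (sigma g s K1 * P K2 ^ 2 + sigma g s K2 * P K1 ^ 2)))
    with (m * ((sigma g s K1 + sigma g s K2) *
           (sigma g s K1 * P K2 ^ 2 + sigma g s K2 * P K1 ^ 2))) by ring.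
  apply Rmult_le_compat_l; [apply Rlt_le, thermal_energy_pos |].
  apply weighted_cauchy_schwarz; apply Rlt_le, sigma_pos.
Qed.

Lemma crossed_alpha_pos : 0 < A.
Proof.
  assert (h : forall k l, 0 < alpha s k * P l)
    by (intros; apply Rmult_lt_0_compat; [apply alpha_pos | apply shifted_press_pos]).
  apply Rplus_lt_0_compat; apply h.
Qed.

Lemma root_gap_pos : 0 < gamma g s * A - S.
Proof. assert (h1 := crossed_sigma_le). assert (h2 := crossed_alpha_pos). lra. Qed.

Lemma press_quadratic :
  press s ^ 2
  = b_at g s (rho s) (eps g s) * press s + c_at g s (rho s) (eps g s).
Proof.
  assert (h : (e + press s) * S = gamma g s * (P K1 * P K2)).
  { rewrite energy_plus_press, <- volume_constraint. ring. }
  unfold b_at, c_at, sum12. fold e.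
  unfold S, crossed_sigma, P, shifted_press in h. rewrite gamma_sigma in *. lra.
Qed.

Lemma root_gap :
  2 * press s - b_at g s (rho s) (eps g s) = gamma g s * A - S.
Proof.
  (* [b] contains [(gamma - 1) e]: replace [e] by [gamma m - p] and use
     [(gamma - 1) m = alpha_1 P_1 + alpha_2 P_2]. *)
  assert (he : e = gamma g s * m - press s)
    by (assert (h := energy_plus_press); lra).
  assert (hm : (sigma g s K1 + sigma g s K2) * m
               = alpha s K1 * P K1 + alpha s K2 * P K2)
    by (rewrite Rmult_plus_distr_r, !sigma_thermal_energy; reflexivity).
  transitivity (2 * press s
    - ((sigma g s K1 + sigma g s K2) * e
       - sigma g s K1 * pstar g K1 - sigma g s K2 * pstar g K2
       - pstar g K1 - pstar g K2)).
  { unfold b_at, sum12. fold e. ring. }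
  rewrite he.
  replace ((sigma g s K1 + sigma g s K2) * (gamma g s * m - press s))
    with (gamma g s * ((sigma g s K1 + sigma g s K2) * m)
          - (sigma g s K1 + sigma g s K2) * press s) by ring.
  rewrite hm, gamma_sigma. unfold A, S, crossed_alpha, crossed_sigma.
  rewrite sum_alpha. unfold P, shifted_press. ring.
Qed.

Lemma d_at_root_gap : d_at g s (rho s) (eps g s) = (gamma g s * A - S) ^ 2.
Proof.
  rewrite <- root_gap. unfold d_at. assert (h := press_quadratic).
  (* [d = b^2 + 4 (p^2 - b p)] is the square of [2 p - b]. *)
  replace (c_at g s (rho s) (eps g s))
    with (press s ^ 2 - b_at g s (rho s) (eps g s) * press s) by lra.
  ring.
Qed.

Lemma sqrt_d_at : sqrt (d_at g s (rho s) (eps g s)) = gamma g s * A - S.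
Proof. rewrite d_at_root_gap. apply sqrt_pow2, Rlt_le, root_gap_pos. Qed.

Lemma press_pplus_at : press s = pplus_at g s (rho s) (eps g s).
Proof. unfold pplus_at. rewrite sqrt_d_at, <- root_gap. field. Qed.

(** * The speed of sound *)

(** The chain rule for a curve [t -> (x t, y t)] through [(rho, eps)]: only the
    derivative [z'] of [x (y - eps_0)] matters, and the slope [S / sqrt d] is
    [dp/de].  It serves for both partial derivatives. *)
Lemma is_derive_pplus_at (x y : R -> R) (t z' : R) :
  x t = rho s -> y t = eps g s ->
  is_derive (fun u => x u * (y u - eps0 g s)) t z' ->
  is_derive (fun u => pplus_at g s (x u) (y u)) t (S / (gamma g s * A - S) * z').
Proof.
  intros hx hy hz.
  assert (hgap := root_gap_pos).
  assert (hd : b_at g s (x t) (y t) ^ 2 + 4 * c_at g s (x t) (y t)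
               = (gamma g s * A - S) ^ 2)
    by (rewrite hx, hy; apply d_at_root_gap).
  replace (S / (gamma g s * A - S) * z')
    with (((sigma g s K1 + sigma g s K2) * z' * press s
           + (sigma g s K1 * pstar g K2 + sigma g s K2 * pstar g K1) * z')
          / sqrt (b_at g s (x t) (y t) ^ 2 + 4 * c_at g s (x t) (y t))).
  - apply (is_derive_larger_root (fun u => b_at g s (x u) (y u))
             (fun u => c_at g s (x u) (y u))).
    + apply (is_derive_affine_comp _ _ _
        (sigma g s K1 * pstar g K1 + sigma g s K2 * pstar g K2
         + pstar g K1 + pstar g K2) _ _ hz).
      intros u. unfold b_at, sum12. ring.
    + now apply (is_derive_affine_comp _ _ _
        (gamma g s * pstar g K1 * pstar g K2) _ _ hz).
    + rewrite hd. now apply pow_lt.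
    + rewrite hx, hy. apply press_pplus_at.
  - rewrite hd, sqrt_pow2 by lra.
    unfold S at 2, crossed_sigma, shifted_press. field. lra.
Qed.

Lemma cs2_eq :
  cs2 g s = gamma g s * cV g s * theta s * (S / (gamma g s * A - S)).
Proof.
  assert (hgap := root_gap_pos). assert (hr := rho_pos).
  assert (hx : Derive (fun x => pplus_at g s x (eps g s)) (rho s)
               = S / (gamma g s * A - S) * (eps g s - eps0 g s)).
  { apply is_derive_unique,
      (is_derive_pplus_at (fun x => x) (fun _ => eps g s)); try reflexivity.
    auto_derive; [exact I | ring]. }
  assert (hy : Derive (fun y => pplus_at g s (rho s) y) (eps g s)
               = S / (gamma g s * A - S) * rho s).
  { apply is_derive_unique,
      (is_derive_pplus_at (fun _ => rho s) (fun y => y)); try reflexivity.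
    auto_derive; [exact I | ring]. }
  unfold cs2. rewrite <- press_pplus_at, hx, hy.
  transitivity (S / (gamma g s * A - S) * (e + press s) / rho s).
  - unfold e. field. lra.
  - rewrite energy_plus_press. unfold m, thermal_energy. field. lra.
Qed.

Lemma cs2_le : cs2 g s <= gamma g s * (gamma g s - 1) * cV g s * theta s.
Proof.
  assert (hgap := root_gap_pos).
  assert (h1 := sigma_pos K1). assert (h2 := sigma_pos K2).
  assert (hgam := gamma_sigma).
  assert (hc : 0 < cV g s * theta s).
  { apply (Rmult_lt_reg_l (rho s)); [apply rho_pos |].
    rewrite Rmult_0_r, <- Rmult_assoc. apply thermal_energy_pos. }
  assert (hratio : S / (gamma g s * A - S) <= gamma g s - 1).
  { apply Rle_div_l; [exact hgap |].
    assert (h : gamma g s * S <= gamma g s * ((gamma g s - 1) * A))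
      by (apply Rmult_le_compat_l; [lra | apply crossed_sigma_le]).
    lra. }
  rewrite cs2_eq.
  replace (gamma g s * (gamma g s - 1) * cV g s * theta s)
    with (gamma g s * cV g s * theta s * (gamma g s - 1)) by ring.
  apply Rmult_le_compat_l; [| exact hratio].
  rewrite Rmult_assoc. apply Rmult_le_pos; lra.
Qed.

(** The weights are the heat capacities [rho_k c_{Vk}], for which [gamma - 1] is
    the mean of the [gamma_k - 1]. *)
Lemma mean_component_speed_ge :
  gamma g s * (gamma g s - 1) * cV g s * theta s
    <= sum12 (fun k => rhok s k / rho s * cs2k g s k).
Proof.
  set (w := fun k => rhok s k * cVk g k).
  set (x := fun k => gammak g k - 1).
  set (W := w K1 + w K2).
  assert (hw1 : 0 < w K1) by apply heat_capacity_pos.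
  assert (hw2 : 0 < w K2) by apply heat_capacity_pos.
  assert (hr := rho_pos). assert (ht := theta_pos).
  assert (hW : 0 < W) by (unfold W; lra).
  assert (hcV : cV g s = W / rho s) by reflexivity.
  assert (hgam : gamma g s = (w K1 * x K1 + w K2 * x K2) / W + 1).
  { unfold gamma, Rmix, mass_mean. rewrite hcV.
    unfold sum12, Rk, w, x. field. split; lra. }
  set (X := w K1 * x K1 + w K2 * x K2) in *.
  set (Q := w K1 * x K1 ^ 2 + w K2 * x K2 ^ 2).
  assert (hlhs : gamma g s * (gamma g s - 1) * cV g s * theta s
                 = theta s / rho s * (X ^ 2 / W + X)).
  { rewrite hgam, hcV. field. split; lra. }
  assert (hrhs : sum12 (fun k => rhok s k / rho s * cs2k g s k)
                 = theta s / rho s * (Q + X)).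
  { unfold sum12, cs2k, Q, X, w, x. field. lra. }
  rewrite hlhs, hrhs.
  apply Rmult_le_compat_l; [now apply Rlt_le, Rdiv_lt_0_compat |].
  apply Rplus_le_compat_r, Rle_div_l; [exact hW |].
  rewrite Rmult_comm. apply weighted_cauchy_schwarz; lra.
Qed.

Lemma mean_component_speed_eq :
  sum12 (fun k => rhok s k / rho s * cs2k g s k)
    = 1 / rho s * sum12 (fun k => alpha s k * gammak g k * (pk g s k + pstar g k)).
Proof.
  assert (hr := rho_pos).
  unfold sum12, cs2k, pk, Rk, rhok. field. lra.
Qed.

End MixtureState.

Theorem proposition7 (g : constants) (s : state)
    (hg : admissible_constants g) (hs : mixture_state g s) :
  cs2 g s <= gamma g s * (gamma g s - 1) * cV g s * theta s /\
  gamma g s * (gamma g s - 1) * cV g s * theta s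
    <= sum12 (fun k => rhok s k / rho s * cs2k g s k) /\
  sum12 (fun k => rhok s k / rho s * cs2k g s k)
    = 1 / rho s * sum12 (fun k => alpha s k * gammak g k * (pk g s k + pstar g k)).
Proof.
  split; [| split].
  - now apply cs2_le.
  - now apply mean_component_speed_ge.
  - now apply mean_component_speed_eq.
Qed.
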